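(* Let $V$ be a uniformly convex and uniformly smooth Banach space, let $V=\sum_{j=1}^N V_j$ with closed subspaces $V_j$, and let $F_0, F_1 \colon V \to \mathbb{R}$ be G\^{a}teaux differentiable and convex, where $F_0$ is semicoercive with respect to a seminorm $|\cdot|$ on $V$ and $F_1$ is coercive. For $\epsilon>0$ let $F = F_0+\epsilon F_1$. Suppose that: (Local smoothness) for some $q>1$ and every $j \in \{1,\dots,N\}$: for any $\|\cdot\|$-bounded convex subset $K \subset V$ and any $\|\cdot\|$-bounded convex subset $K_j \subset V_j$ with $0 \in K_j$, $\sup_{v\in K, w_j \in K_j} d_{0,j}(w_j;v)/\|w_j\|^q<\infty$ and $\sup_{v\in K, w_j \in K_j} d_{1,j}(w_j;v)/\|w_j\|^q<\infty$; (Uniform convexity) for some $p \ge q$: for any $|\cdot|$-bounded convex subset $K \subset V$, $$\mu_{0,K} := p\inf_{v,v+w\in K} \frac{d_{F_0}(w;v)}{|w|^p}>0,$$ and for any $\|\cdot\|$-bounded convex subset $K\subset V$, $$\mu_{1,K} := p\inf_{v,v+w\in K} \frac{d_{F_0}(w;v)+d_{F_1}(w;v)}{\|w\|^p}>0.$$ Given $u^{(0)}\in V$, let $K_0 = \{v\in V: F(v)\le F(u^{(0)})\}$, let $u$ be a minimizer of $F$, and let $$\mu_{K_0} := p\inf_{v\in K_0}\frac{F(v)-F(u)}{\|v-u\|_{\epsilon,q}^p}.$$ If $\epsilon\in(0,1/2]$, then $\mu_{K_0}$ has a positive lower bound independent of $\epsilon$ (except for the possible dependence on $\epsilon$ through $K_0$);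 that is, there is an assignment $K\mapsto c(K)>0$ on bounded convex subsets $K$ of $V$, not depending on $\epsilon$, such that $\mu_{K_0}\ge c(K_0)$ for all $\epsilon \in (0,1/2]$.
   Context: Semicoercivity with respect to a seminorm: $F_0$ is semicoercive with respect to $|\cdot|$ if $|\cdot|$ is a continuous seminorm on $V$ such that, with $\ker|\cdot| = \{v \in V : |v| = 0\}$, there is a constant $C'>0$ with $\inf_{\phi \in \ker|\cdot|} \|v+\phi\| \le C'|v|$ for all $v \in V$; $F_0(v)=F_0(v+\phi)$ for all $v \in V$, $\phi \in \ker|\cdot|$; and $F_0(v) \to \infty$ as $|v| \to \infty$. Coercive means $F_1(v)\to\infty$ as $\|v\|\to\infty$. For $i\in\{0,1\}$ and $v,w\in V$: $d_{F_i}(w;v) = F_i(v+w)-F_i(v)-\langle F_i'(v),w\rangle$ (Bregman distance), and $d_{i,j}(w_j;v) = d_{F_i}(w_j;v)$ for $w_j\in V_j$. The norm $\|\cdot\|_{\epsilon,q}$ is $\|v\|_{\epsilon,q}=(|v|^q+\epsilon\|v\|^q)^{1/q}$. Convention: $0/0=0$ for arguments of a supremum and $0/0=+\infty$ for arguments of an infimum. *)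

(* Defs.v *)
From HB Require Import structures.
From mathcomp Require Import all_boot all_order all_algebra.
From mathcomp Require Import all_classical all_reals all_analysis.

Set Implicit Arguments.
Unset Strict Implicit.
Unset Printing Implicit Defensive.

Import Order.TTheory GRing.Theory Num.Theory.
Import numFieldNormedType.Exports.

Local Open Scope classical_set_scope.
Local Open Scope ring_scope.

Definition uniformly_convex_space (R : realType) (V : normedModType R) : Prop :=
  forall e : R, 0 < e -> e <= 2 -> exists2 delta : R, 0 < delta &
    forall x y : V, `|x| = 1 -> `|y| = 1 -> e <= `|x - y| ->
      `|2^-1 *: (x + y)| <= 1 - delta.

Definition uniformly_smooth_space (R : realType) (V : normedModType R) : Prop :=
  forall e : R, 0 < e -> exists2 delta : R, 0 < delta &
    forall x y : V, `|x| = 1 -> `|y| <= delta ->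
      `|x + y| + `|x - y| <= 2 + e * `|y|.

Definition closed_subspace (R : realType) (V : normedModType R) (U : set V) : Prop :=
  closed U /\ submod_closed (fun v : V => v \in U).

Definition space_sum (R : realType) (V : normedModType R) (N : nat)
    (Vj : 'I_N -> set V) : Prop :=
  forall v : V, exists2 w : 'I_N -> V,
    (forall j, Vj j (w j)) & v = \sum_(j < N) w j.

(* The Gateaux derivative at v is the functional w |-> 'D_w F v; it has to be
   linear and continuous in w, i.e. an element of the dual space. *)
Definition gateaux_differentiable (R : realType) (V : normedModType R)
    (F : V -> R) : Prop :=
  forall v : V, (forall w, derivable F v w) /\
    linear (fun w => 'D_w F v : R^o) /\ continuous (fun w => 'D_w F v).

Definition bregman (R : realType) (V : normedModType R) (F : V -> R) (w v : V) : R :=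
  F (v + w) - F v - 'D_w F v.

Record seminorm (R : realType) (V : normedModType R) (sn : V -> R) : Prop :=
  Seminorm {
    seminorm_ge0 : forall v, 0 <= sn v;
    seminormZ : forall (a : R) v, sn (a *: v) = `|a| * sn v;
    seminormD : forall v w, sn (v + w) <= sn v + sn w
  }.

Definition seminorm_ker (R : realType) (V : normedModType R) (sn : V -> R) : set V :=
  [set v | sn v = 0].

(* F v --> +oo as s v --> +oo *)
Definition tends_to_infty_along (R : realType) (V : Type) (s F : V -> R) : Prop :=
  forall A : R, exists M : R, forall v, M <= s v -> A <= F v.

Definition coercive (R : realType) (V : normedModType R) (F : V -> R) : Prop :=
  tends_to_infty_along (fun v : V => `|v|) F.

Record semicoercive (R : realType) (V : normedModType R) (sn F : V -> R) : Prop :=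
  Semicoercive {
    semicoercive_seminorm : seminorm sn;
    semicoercive_continuous : continuous sn;
    semicoercive_quotient : exists2 C : R, 0 < C & forall v : V,
      inf [set `|v + phi| | phi in seminorm_ker sn] <= C * sn v;
    semicoercive_invariant : forall v phi : V,
      seminorm_ker sn phi -> F v = F (v + phi);
    semicoercive_infty : tends_to_infty_along sn F
  }.

(* x / y with the value z for 0 / 0, and +oo or -oo for x / 0 with x <> 0. *)
Definition quot (R : realType) (z : \bar R) (x y : R) : \bar R :=
  if y == 0 then if x == 0 then z else (x%:E * +oo)%E else (x / y)%:E.

Definition sup_quot (R : realType) (x y : R) : \bar R := quot 0%E x y.

Definition inf_quot (R : realType) (x y : R) : \bar R := quot +oo%E x y.

Definition local_smoothness (R : realType) (V : normedModType R) (q : R)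
    (Vj : set V) (F : V -> R) : Prop :=
  forall K Kj : set V, bounded_set K -> convex_set K ->
    Kj `<=` Vj -> bounded_set Kj -> convex_set Kj -> Kj 0 ->
    (ereal_sup [set sup_quot (bregman F w v) (`|w| `^ q)%R | v in K & w in Kj]
      < +oo)%E.

Definition mu0 (R : realType) (V : normedModType R) (sn F0 : V -> R) (p : R)
    (K : set V) : \bar R :=
  (p%:E * ereal_inf [set inf_quot (bregman F0 vw.2 vw.1) (sn vw.2 `^ p)%R
                    | vw in [set vw : V * V | K vw.1 /\ K (vw.1 + vw.2)%R]])%E.

Definition mu1 (R : realType) (V : normedModType R) (F0 F1 : V -> R) (p : R)
    (K : set V) : \bar R :=
  (p%:E * ereal_inf [set inf_quot (bregman F0 vw.2 vw.1 + bregman F1 vw.2 vw.1)%R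
                                  (`|vw.2| `^ p)%R
                    | vw in [set vw : V * V | K vw.1 /\ K (vw.1 + vw.2)%R]])%E.

Definition norm_eps (R : realType) (V : normedModType R) (sn : V -> R)
    (eps q : R) (v : V) : R :=
  (sn v `^ q + eps * `|v| `^ q) `^ q^-1.

Definition energy (R : realType) (V : Type) (F0 F1 : V -> R) (eps : R) (v : V) : R :=
  F0 v + eps * F1 v.

Definition sublevel (R : realType) (V : Type) (F : V -> R) (u0 : V) : set V :=
  [set v | F v <= F u0].

Definition minimizer (R : realType) (V : Type) (F : V -> R) (u : V) : Prop :=
  forall v, F u <= F v.

Definition mu_sharp (R : realType) (V : normedModType R) (sn F : V -> R)
    (eps q p : R) (K0 : set V) (u : V) : \bar R :=
  (p%:E * ereal_inf [set inf_quot (F v - F u)%R (norm_eps sn eps q (v - u)%R `^ p)%R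
                    | v in K0])%E.

(* Main.v *)
Require Import Defs.
From mathcomp Require Import all_boot all_order all_algebra.
From mathcomp Require Import all_classical all_reals all_analysis.
From mathcomp Require Import ring lra.

Import Order.TTheory GRing.Theory Num.Theory.
Import numFieldNormedType.Exports.

Local Open Scope classical_set_scope.
Local Open Scope ring_scope.

(** The minimizer [u] is a critical point of [F = F0 + eps F1], so the energy
    gap at [v = u + w] is bounded below by a sum of Bregman distances
    (lemma [minimizer_gap_ge]):
    [F v - F u >= d0 + eps d1 = (1 - eps) d0 + eps (d0 + d1)].
    The two uniform convexity hypotheses on [K0] give [d0 >= k0 |w|^p] for the
    seminorm and [d0 + d1 >= k1 ||w||^p] for the norm.  Since [eps <= 1/2],
    the factor [1 - eps] is at least [1/2], whence
    [F v - F u >= min (k0/2, k1) (|w|^p + eps ||w||^p)].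
    The bracket dominates [||w||_{eps,q}^p] up to the constant [2^(p/q)]
    (lemma [norm_eps_powR_le]): this is where [q <= p] and [eps <= 1] enter,
    through [eps^(p/q) <= eps].  The resulting constant depends on [K0] only
    through [k0] and [k1] (lemma [bregman_energy_ge]).

    The convexity hypotheses apply to [K0] provided that it is convex and
    norm-bounded.  Boundedness follows from the coercivity of [F1] as soon as
    [F0] is bounded below (lemma [semicoercive_bounded_below]), and
    norm-bounded sets are seminorm-bounded because the seminorm is
    continuous. *)

Set Implicit Arguments.
Unset Strict Implicit.

(** With the value [+oo] for [0 / 0] and a signed infinity for [x / 0], a lower
    bound on the quotient is exactly the inequality cleared of denominators,
    even when the denominator vanishes. *)
Lemma inf_quotP (R : realType) (k x y : R) : 0 <= y ->
  (k%:E <= inf_quot x y)%E <-> k * y <= x.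
Proof.
move=> y0; rewrite /inf_quot /quot.
have [->|yn0] := eqVneq y 0.
  rewrite mulr0; have [->|xn0] := eqVneq x 0; first by rewrite lexx leey.
  case: (ltgtP x 0) xn0 => // [x0|x0] _.
    by rewrite lt0_muley ?lte_fin.
  by rewrite gt0_muley ?lte_fin// leey.
by rewrite lee_fin ler_pdivlMr// lt0r yn0.
Qed.

(** The infimum may be [+oo], for instance over a single point; any positive
    real is then a valid constant. *)
Lemma gt0_scaled_inf_quot (R : realType) (I : Type) (D : set I)
    (x y : I -> R) (p : R) : 0 < p -> (forall i, 0 <= y i) ->
  (0 < p%:E * ereal_inf [set inf_quot (x i) (y i) | i in D])%E ->
  exists2 k, 0 < k & forall i, D i -> k * y i <= x i.
Proof.
move=> p0 y0; rewrite pmule_rgt0 ?lte_fin//.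
set m := ereal_inf _ => m0.
have [k k0 km] : exists2 k, 0 < k & (k%:E <= m)%E.
  move: m0; case: m => [m m0| _|//].
    by exists m.
  by exists 1; rewrite ?ltr01// leey.
exists k => // i Di; apply/inf_quotP => //; apply: le_trans km _.
by apply: ereal_inf_lbound; exists i.
Qed.

Lemma scaled_inf_quot_ge (R : realType) (I : Type) (D : set I)
    (x y : I -> R) (p k : R) : 0 < p -> (forall i, 0 <= y i) ->
  (forall i, D i -> k * y i <= p * x i) ->
  (k%:E <= p%:E * ereal_inf [set inf_quot (x i) (y i) | i in D])%E.
Proof.
move=> p0 y0 kxy; rewrite -lee_pdivrMl//; apply/ereal_infP => _ [i Di <-].
by rewrite -EFinM; apply/inf_quotP => //; rewrite -mulrA ler_pdivrMl// kxy.
Qed.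

(** A sum is at most twice its larger term. *)
Lemma powR_addr_le (R : realType) (r a b : R) : 0 <= r -> 0 <= a -> 0 <= b ->
  (a + b) `^ r <= 2 `^ r * (a `^ r + b `^ r).
Proof.
move=> r0 a0 b0.
wlog ab : a b a0 b0 / a <= b => [hw|].
  by have [/hw|/ltW/hw] := leP a b; [exact | rewrite addrC [X in _ * X]addrC; exact].
apply: (@le_trans _ _ ((2 * b) `^ r)).
  by apply: ge0_ler_powR; rewrite ?nnegrE//; lra.
by rewrite powRM// ler_wpM2l ?powR_ge0// lerDr powR_ge0.
Qed.

(** The exponent [p / q] is at least 1, so it can only decrease the weight
    [eps <= 1]; hence a single factor [eps] survives on the right. *)
Lemma norm_eps_powR_le (R : realType) (V : normedModType R) (sn : V -> R)
    (eps q p : R) (w : V) : (forall v, 0 <= sn v) ->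
  0 < q -> q <= p -> 0 < eps -> eps <= 1 ->
  norm_eps sn eps q w `^ p <= 2 `^ (p / q) * (sn w `^ p + eps * `|w| `^ p).
Proof.
move=> sn0 q0 qp e0 e1; rewrite /norm_eps -powRrM.
have r1 : 1 <= q^-1 * p by rewrite mulrC ler_pdivlMr// mul1r.
have qrp : q * (q^-1 * p) = p by rewrite mulVKf// gt_eqF.
rewrite [p / q]mulrC; apply: le_trans (powR_addr_le _ _ _) _.
- exact: le_trans r1.
- exact: powR_ge0.
- by rewrite mulr_ge0 ?powR_ge0// ltW.
rewrite ler_wpM2l ?powR_ge0// -powRrM qrp lerD2l.
have := @ge1r_powRZ R eps (`|w| `^ q) (q^-1 * p).
by rewrite -powRrM qrp; apply; rewrite ?powR_ge0 ?e0.
Qed.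

(** Sign arguments on difference quotients need [h > 0], which the punctured
    neighbourhood in the definition of the derivative does not provide. *)
Lemma cvg_right_derive (R : realType) (V : normedModType R) (f : V -> R)
    (v w : V) : derivable f v w ->
  h^-1 * (f (h *: w + v) - f v) @[h --> 0^'+] --> 'D_w f v.
Proof. by move=> df; apply: cvg_dnbhs_at_right; exact: df. Qed.

Lemma derive_minimizer_ge0 (R : realType) (V : normedModType R) (f : V -> R)
    (u w : V) : minimizer f u -> derivable f u w -> 0 <= 'D_w f u.
Proof.
move=> fmin /cvg_right_derive du; apply: (cvgr_to_ge du); near=> h.
by rewrite mulr_ge0// ?invr_ge0 // subr_ge0 fmin.
Unshelve. all: by end_near. Qed.

(** By convexity the difference quotients [(f (v + h w) - f v) / h] with
    [0 < h <= 1] are at most [f (v + w) - f v], and so is their limit. *)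
Lemma bregman_ge0 (R : realType) (V : normedModType R) (f : V -> R)
    (w v : V) : convex_function setT f -> derivable f v w ->
  0 <= bregman f w v.
Proof.
move=> fconv /cvg_right_derive dv; rewrite /bregman subr_ge0.
apply: (cvgr_to_le dv); near=> h.
have h0 : 0 < h by near: h; exact: nbhs_right_gt.
have h1 : h <= 1 by near: h; exact: nbhs_right_le.
rewrite ler_pdivrMl//.
have := fconv (Itv01 (ltW h0) h1) (v + w) v; rewrite !inE => /(_ I I).
rewrite convRE /= /conv /= /unstable.onem.
have -> : h *: (v + w) + (1 - h) *: v = h *: w + v.
  by rewrite scalerDr scalerBl scale1r addrC addrA subrK addrC.
by lra.
Unshelve. all: by end_near. Qed.

(** Stated for absolutely homogeneous functions so as to cover both continuous
    seminorms and absolute values of continuous linear functionals: a bound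
    near 0 is carried to any ball by scaling. *)
Lemma homogeneous_bounded (R : realType) (V : normedModType R) (g : V -> R)
    (r : R) : (forall a v, g (a *: v) = `|a| * g v) -> continuous g ->
  exists B, forall v, `|v| <= r -> g v <= B.
Proof.
move=> gZ gcont.
have g0 : g 0 = 0 by rewrite -[0 in LHS](scale0r 0) gZ normr0 mul0r.
have : \forall x \near (0 : V), g x < 1.
  have := gcont 0; rewrite /continuous_at g0 => h.
  by apply: (cvgr_lt _ h).
move=> /nbhs_norm0P[d /= d0 gd].
pose s := Num.max r 1.
have s0 : 0 < s by rewrite lt_max ltr01 orbT.
(* [s] replaces [r] by a positive radius; the factor 2 makes the rescaled
   point fall strictly inside the ball of radius [d] where [g < 1]. *)
exists (2 * s / d) => v vr.
have c0 : 0 < d / (2 * s) by rewrite divr_gt0 ?mulr_gt0.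
have /gd/= : `|(d / (2 * s)) *: v| < d.
  rewrite normrZ gtr0_norm// mulrAC ltr_pdivrMr ?mulr_gt0// ltr_pM2l//.
  have : `|v| <= s by rewrite (le_trans vr)// le_max lexx.
  lra.
rewrite gZ gtr0_norm// -ltr_pdivlMl// mulr1 invf_div => /ltW //.
Qed.

(** Where the seminorm is large, [f] is nonnegative.  Elsewhere the quotient
    bound yields a translate of [v] by the kernel that has bounded norm and the
    same value of [f]; there the affine minorant of [f] given by the derivative
    at 0 is bounded below. *)
Lemma semicoercive_bounded_below (R : realType) (V : normedModType R)
    (sn f : V -> R) : gateaux_differentiable f -> convex_function setT f ->
  semicoercive sn f -> exists m, forall v, m <= f v.
Proof.
move=> fdiff fconv [[sn0 snZ snD] _ [C C0 snC] finv finfty].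
have [fd [flin fcont]] := fdiff 0.
have [M fM] := finfty 0.
(* [C * M + 1]: the infimum over the kernel is below [C * M + 1], hence some
   translate has norm below it, even if the infimum is not attained. *)
have [||B fB] := @homogeneous_bounded R V (fun x => `|'D_x f 0|) (C * M + 1).
- move=> a v; have := flin a v 0; rewrite addr0 -normrM.
  have D0 : 'D_0 f 0 = 0.
    by have := flin (-1) 0 0; rewrite scaler0 addr0 scaleN1r addNr.
  by rewrite D0 addr0 => ->.
- by move=> x; apply: cvg_norm; exact: fcont.
exists (Num.min 0 (f 0 - B)) => v; rewrite ge_min.
have [/fM->//|vM] := leP M (sn v); apply/orP; right.
have [_ [phi phi0 <-] phiv] : exists2 y,
    [set `|v + phi| | phi in seminorm_ker sn] y & y < C * M + 1.
  apply: inf_lt.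
    by exists `|v + 0|, 0 => //; rewrite /seminorm_ker /= -(scale0r 0) snZ normr0 mul0r.
  apply: le_lt_trans (snC v) _; rewrite ltr_wpDr// ltr_pM2l//.
rewrite (finv v _ phi0).
have := @bregman_ge0 R V f (v + phi) 0 fconv (fd _).
rewrite /bregman add0r.
have /= := fB _ (ltW phiv); rewrite ler_norml => /andP[].
lra.
Qed.

Lemma sublevel_convex (R : realType) (V : normedModType R) (f : V -> R)
    (u0 : V) : convex_function setT f -> convex_set (sublevel f u0).
Proof.
move=> fconv x y t; rewrite !inE /sublevel /= => fx fy.
apply: le_trans (fconv t x y _ _) _; rewrite ?inE//.
have -> : f u0 = t%:num * f u0 + (1 - t%:num) * f u0 by lra.
by rewrite convRE lerD// ler_wpM2l// subr_ge0.
Qed.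

Lemma energy_convex (R : realType) (V : normedModType R) (F0 F1 : V -> R)
    (eps : R) : 0 <= eps -> convex_function setT F0 ->
  convex_function setT F1 -> convex_function setT (energy F0 F1 eps).
Proof.
move=> e0 c0 c1 t x y xT yT; rewrite /energy.
have := c0 t x y xT yT.
have := ler_wpM2l e0 (c1 t x y xT yT).
rewrite !convRE; lra.
Qed.

(** On the sublevel set, [eps * F1] is at most the level minus the lower bound
    of [F0], so coercivity of [F1] bounds the norm. *)
Lemma energy_sublevel_bounded (R : realType) (V : normedModType R)
    (F0 F1 : V -> R) (eps m : R) (u0 : V) : 0 < eps -> (forall v, m <= F0 v) ->
  coercive F1 -> bounded_set (sublevel (energy F0 F1 eps) u0).
Proof.
move=> e0 F0m F1c.
(* The summand 1 turns the non-strict bound of coercivity into a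
   contradiction. *)
have [M FM] := F1c ((energy F0 F1 eps u0 - m) / eps + 1).
rewrite /= /bounded_near; near=> r => v; rewrite /sublevel /= => vu.
apply: (@le_trans _ _ M); last by near: r; apply: nbhs_pinfty_ge; exact: num_real.
rewrite leNgt; apply/negP => /ltW/FM; apply/negP; rewrite -ltNge.
apply: ltr_pwDr => //; rewrite ler_pdivlMr// mulrC.
by have := F0m v; move: vu; rewrite /energy; lra.
Unshelve. all: by end_near. Qed.

Lemma seminorm_bounded (R : realType) (V : normedModType R) (sn : V -> R)
    (K : set V) : seminorm sn -> continuous sn -> bounded_set K ->
  [bounded sn v | v in K].
Proof.
move=> [sn0 snZ _] snC /ex_strict_bound_gt0[r _ Kr].
have [B snB] := homogeneous_bounded r snZ snC.
rewrite /= /bounded_near; near=> s => v Kv /=; rewrite ger0_norm//.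
apply: (@le_trans _ _ B); last by near: s; apply: nbhs_pinfty_ge; exact: num_real.
by apply: snB; exact/ltW/Kr.
Unshelve. all: by end_near. Qed.

(** The order of quantifiers is the point: [c] is chosen before [eps]. *)
Lemma bregman_energy_ge (R : realType) (V : normedModType R) (sn F0 F1 : V -> R)
    (q p : R) (K : set V) : (forall v, 0 <= sn v) -> 0 < q -> q <= p ->
  (0 < mu0 sn F0 p K)%E -> (0 < mu1 F0 F1 p K)%E ->
  exists2 c, 0 < c & forall eps, 0 < eps -> eps <= 2^-1 ->
    forall v w, K v -> K (v + w) ->
    c * norm_eps sn eps q w `^ p <= p * (bregman F0 w v + eps * bregman F1 w v).
Proof.
move=> sn0 q0 qp + +; have p0 : 0 < p := lt_le_trans q0 qp.
move=> /gt0_scaled_inf_quot[//||k0 k0gt0 k0P].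
  by move=> vw; exact: powR_ge0.
move=> /gt0_scaled_inf_quot[//||k1 k1gt0 k1P].
  by move=> vw; exact: powR_ge0.
pose k := Num.min (k0 / 2) k1.
have k_gt0 : 0 < k by rewrite lt_min k1gt0 andbT divr_gt0.
exists (p * (k / 2 `^ (p / q))) => [|eps e0 e2 v w Kv Kvw].
  by rewrite mulr_gt0// divr_gt0// powR_gt0.
rewrite -[_ * _ * norm_eps _ _ _ _ `^ _]mulrA ler_wpM2l ?(ltW p0)//.
have := @norm_eps_powR_le R V sn eps q p w sn0 q0 qp e0 ltac:(lra).
move=> /(ler_wpM2l (ltW (divr_gt0 k_gt0 (powR_gt0 (p / q) (ltr0n R 2))))).
rewrite mulrA divfK ?gt_eqF ?powR_gt0// => /le_trans; apply.
have := k0P (v, w) (conj Kv Kvw); have := k1P (v, w) (conj Kv Kvw) => /=.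
set a := sn w `^ p; set b := `|w| `^ p.
set d0 := bregman F0 w v; set d1 := bregman F1 w v => h1 h0.
have a0 : 0 <= a by exact: powR_ge0.
have b0 : 0 <= b by exact: powR_ge0.
have kk0 : k <= k0 / 2 by rewrite ge_min lexx.
have kk1 : k <= k1 by rewrite ge_min lexx orbT.
(* Borrowing [eps * d0] is what makes the mixed term [d0 + d1] appear. *)
have -> : d0 + eps * d1 = (1 - eps) * d0 + eps * (d0 + d1) by ring.
rewrite mulrDr lerD//.
  apply: (@le_trans _ _ (2^-1 * d0)).
    by have := ler_wpM2r a0 kk0; lra.
  by apply: ler_wpM2r; [exact: le_trans (mulr_ge0 (ltW k0gt0) a0) h0 | lra].
by rewrite mulrCA ler_wpM2l ?(ltW e0)// (le_trans _ h1)// ler_wpM2r.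
Qed.

(** The gap differs from the Bregman distance of the energy by its directional
    derivative, which is nonnegative at a minimizer. *)
Lemma minimizer_gap_ge (R : realType) (V : normedModType R) (F0 F1 : V -> R)
    (eps : R) (u w : V) : derivable F0 u w -> derivable F1 u w ->
  minimizer (energy F0 F1 eps) u ->
  bregman F0 w u + eps * bregman F1 w u <=
  energy F0 F1 eps (u + w) - energy F0 F1 eps u.
Proof.
move=> d0 d1 umin.
have d1e : derivable (eps *: F1) u w by exact: derivableZ.
have := derive_minimizer_ge0 umin (derivableD d0 d1e).
rewrite deriveD// deriveZ// /bregman /energy.
rewrite -[_ *: _]/(eps * _); lra.
Qed.

Unset Implicit Arguments.
Set Strict Implicit.

Theorem theorem5p10 (R : realType) (V : completeNormedModType R)
    (hVconvex : uniformly_convex_space V) (hVsmooth : uniformly_smooth_space V)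
    (N : nat) (Vj : 'I_N -> set V)
    (hVj : forall j, closed_subspace (Vj j)) (hVsum : space_sum Vj)
    (sn F0 F1 : V -> R)
    (hF0diff : gateaux_differentiable F0) (hF1diff : gateaux_differentiable F1)
    (hF0convex : convex_function setT F0) (hF1convex : convex_function setT F1)
    (hF0 : semicoercive sn F0) (hF1 : coercive F1)
    (q p : R) (hq : 1 < q) (hpq : q <= p)
    (hsmooth0 : forall j, local_smoothness q (Vj j) F0)
    (hsmooth1 : forall j, local_smoothness q (Vj j) F1)
    (hmu0 : forall K : set V, [bounded sn v | v in K] -> convex_set K ->
      (0 < mu0 sn F0 p K)%E)
    (hmu1 : forall K : set V, bounded_set K -> convex_set K ->
      (0 < mu1 F0 F1 p K)%E)
    (u0 : V) :
  exists c : set V -> R,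
    (forall K : set V, bounded_set K -> convex_set K -> 0 < c K) /\
    forall eps : R, 0 < eps -> eps <= 2^-1 ->
      let F := energy F0 F1 eps in
      let K0 := sublevel F u0 in
      forall u : V, minimizer F u ->
        bounded_set K0 /\ convex_set K0 /\
        ((c K0)%:E <= mu_sharp sn F eps q p K0 u)%E.
Proof.
have [snS snC _ _ _] := hF0; have sn0 := seminorm_ge0 snS.
have q0 : 0 < q by exact: lt_trans hq.
have p0 : 0 < p by exact: lt_le_trans hpq.
have [m F0m] := semicoercive_bounded_below hF0diff hF0convex hF0.
(* The constant is chosen as a function of the set alone, before [eps] and [u]
   are introduced; its value outside bounded convex sets is arbitrary. *)
have /choice[c cP] : forall K : set V, exists c, bounded_set K -> convex_set K ->
    0 < c /\ forall eps, 0 < eps -> eps <= 2^-1 -> forall v w, K v -> K (v + w) ->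
    c * norm_eps sn eps q w `^ p <= p * (bregman F0 w v + eps * bregman F1 w v).
  move=> K; have [Kb|] := pselect (bounded_set K); last by exists 0.
  have [Kc|] := pselect (convex_set K); last by exists 0.
  have [c c0 cP] := bregman_energy_ge sn0 q0 hpq
    (hmu0 K (seminorm_bounded snS snC Kb) Kc) (hmu1 K Kb Kc).
  by exists c.
exists c; split => [K Kb Kc|eps e0 e2 F K0 u umin].
  by have [] := cP K Kb Kc.
have K0b : bounded_set K0 by exact: energy_sublevel_bounded F0m hF1.
have K0c : convex_set K0.
  by apply: sublevel_convex; apply: energy_convex => //; exact: ltW.
split=> //; split=> //; have [_ cK0] := cP K0 K0b K0c.
apply: scaled_inf_quot_ge => // [v|v K0v]; first exact: powR_ge0.
have uvE : u + (v - u) = v by rewrite addrC subrK.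
have K0u : K0 u by exact: umin.
have := cK0 eps e0 e2 u (v - u) K0u; rewrite uvE => /(_ K0v)/le_trans; apply.
rewrite ler_wpM2l ?(ltW p0)//.
have := @minimizer_gap_ge R V F0 F1 eps u (v - u).
rewrite uvE; apply => //.
  by have [] := hF0diff u.
by have [] := hF1diff u.
Qed.
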